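(* The graph $\mathrm{KG}(\mathrm{Perm}_n)$ is Hamiltonian, that is, it contains a Hamiltonian cycle.
   Context: Write $[n]=\{1,\dots,n\}$ and let $S_n$ be the symmetric group on $[n]$. The permutohedron is $\mathrm{Perm}_n=\mathrm{conv}\{(\sigma(1),\dots,\sigma(n)) : \sigma\in S_n\}\subset\mathbb{R}^n$; its vertex set is identified with $S_n$. For a polytope $\mathcal{Q}$, the Kneser graph $\mathrm{KG}(\mathcal{Q})$ is the graph whose vertices are the vertices of $\mathcal{Q}$, with two vertices adjacent if and only if they lie on no common facet of $\mathcal{Q}$. The facets of $\mathrm{Perm}_n$ are indexed by the subsets $\emptyset\ne I\subsetneq[n]$, the facet of $I$ consisting of the points of $\mathrm{Perm}_n$ with $\sum_{i\in I}x_i=\binom{|I|+1}{2}$; its vertices are the permutations $\sigma\in S_n$ with $\sigma(I)=\{1,\dots,|I|\}$. Hence two permutations $\sigma,\tau\in S_n$ are adjacent in $\mathrm{KG}(\mathrm{Perm}_n)$ if and only if there is no $k\in\{1,\dots,n-1\}$ with $\sigma^{-1}(\{1,\dots,k\})=\tau^{-1}(\{1,\dots,k\})$.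
   Formalization: The formal statement assumes n ≥ 3; for n = 1 and n = 2 the graph KG(Perm_n) is a single vertex or a single edge, which contains no Hamiltonian cycle. *)

(* Defs.v *)
From mathcomp Require Import all_boot all_order all_algebra.
From mathcomp Require Import perm.
From mathcomp Require Import boolp classical_sets reals convex.

Set Implicit Arguments.
Unset Strict Implicit.
Unset Printing Implicit Defensive.

Import Order.TTheory GRing.Theory Num.Theory.
Local Open Scope classical_set_scope.
Local Open Scope ring_scope.

Record graph (T : Type) := Graph { vertices : set T; adjacent : T -> T -> Prop }.

(* A Hamiltonian cycle has length at least 3, so that it is a genuine cycle of
   a simple graph: graphs with at most two vertices are not Hamiltonian. *)
Definition hamiltonian (T : choiceType) (G : graph T) : Prop :=
  exists s : seq T,
    [/\ (3 <= size s)%N, uniq s, [set` s] = vertices G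
      & cycle (fun x y => `[< adjacent G x y >]) s].

Section Polytopes.
Variables (R : realType) (n : nat).
Implicit Types (Q F : set 'rV[R]_n) (v w : 'rV[R]_n).

Definition convex_hull (A : set 'rV[R]_n) : set 'rV[R]_n :=
  smallest (@convex_set R 'rV[R]_n) A.

Definition dot (c x : 'rV[R]_n) : R := \sum_(i < n) c 0 i * x 0 i.

(* Q itself and the empty set are faces. *)
Definition face Q F : Prop :=
  exists (c : 'rV[R]_n) (b : R),
    (forall x, Q x -> dot c x <= b) /\ F = Q `&` [set x | dot c x = b].

Definition affinely_independent (d : nat) (p : 'I_d.+1 -> 'rV[R]_n) : bool :=
  row_free (\matrix_(i < d) (p (lift ord0 i) - p ord0)).

Definition contains_simplex (A : set 'rV[R]_n) (d : nat) : Prop :=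
  exists p : 'I_d.+1 -> 'rV[R]_n,
    (forall i, A (p i)) /\ affinely_independent p.

(* The empty set has no dimension in this sense; as a face it contains no
   vertex, so it plays no role in the Kneser graph. *)
Definition has_dim (A : set 'rV[R]_n) (d : nat) : Prop :=
  contains_simplex A d /\ forall e, contains_simplex A e -> (e <= d)%N.

Definition facet Q F : Prop :=
  face Q F /\ exists d, has_dim Q d.+1 /\ has_dim F d.

Definition polytope_vertex Q v : Prop := face Q [set v].

Definition kneser_graph Q : graph 'rV[R]_n :=
  Graph [set v | polytope_vertex Q v]
    (fun v w => [/\ polytope_vertex Q v, polytope_vertex Q w, v <> w
                  & ~ exists F, [/\ facet Q F, F v & F w]]).

(* 'I_n is {0, ..., n-1}, hence the shift by one. *)
Definition perm_point (s : 'S_n) : 'rV[R]_n := \row_(i < n) (s i).+1%:R.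

Definition permutohedron : set 'rV[R]_n := convex_hull (range perm_point).

End Polytopes.

Arguments permutohedron R n : clear implicits.

(* Main.v *)
Require Import Defs.
From mathcomp Require Import all_boot all_order all_algebra.
From mathcomp Require Import perm.
From mathcomp Require Import boolp classical_sets reals convex.
From mathcomp Require Import ring lra zify.

(** Read a permutation s as the linear order that it puts on the indices; its
prefixes are the sets that s maps onto an initial segment. Two facts carry the
proof.

A proper face of the permutohedron maximizes a non-constant functional c. If
perm_point s is a maximizer then, by exchanging two values of s, the values
of s increase strictly with c, so the indices at which c is not maximal form a
proper nonempty prefix of s. Two vertices on a common facet therefore share
such a prefix ([proper_face_common_prefix]), and it suffices to find a
Hamiltonian cycle in the graph [no_common_prefix] on the permutations.

That graph is dense: a permutation sharing a prefix with s has a complement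
(its reversed order) that shares none with s ([no_common_prefix_complement]).
Indeed the prefixes of s are nested, so a common prefix I of s and t and a
common prefix J of s and the complement of t would give i in both and j in
neither, and t would have to put i both before and after j. So every vertex has
at least half of all vertices as neighbours, as in Dirac's theorem, and the
involution replaces the counting in Dirac's argument
([antipodal_hamiltonian_cycle]): a path x, ax, y, ay, ... is extended greedily,
since ax is adjacent to y or to ay, and one rotation closes it. *)

Set Implicit Arguments.
Unset Strict Implicit.
Unset Printing Implicit Defensive.

Import Order.TTheory GRing.Theory Num.Theory.

(** * Hamiltonian cycles in graphs with an antipodal involution *)

Section Antipodal.
Variables (T : finType) (e : rel T) (a : T -> T).
Hypotheses (e_irr : irreflexive e) (e_sym : symmetric e).
Hypotheses (aK : involutive a) (e_anti : forall x y, e x y || e x (a y)).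

Definition with_antipodes (s : seq T) : seq T :=
  flatten [seq [:: x; a x] | x <- s].

Lemma adj_antipode x : e x (a x).
Proof. by have := e_anti x x; rewrite e_irr. Qed.

Lemma mem_with_antipodes s x :
  (a x \in with_antipodes s) = (x \in with_antipodes s).
Proof.
elim: s => //= y s IH; rewrite !inE IH (inv_eq aK) (inj_eq (inv_inj aK)).
by case: (x == a y); case: (x == y).
Qed.

Lemma uniq_with_antipodes_cons z s :
  z \notin with_antipodes s -> uniq (with_antipodes s) ->
  uniq (with_antipodes (z :: s)).
Proof.
move=> zs us; rewrite /= us inE negb_or zs mem_with_antipodes zs !andbT.
by apply: contraFneq (e_irr z) => {2}->; exact: adj_antipode.
Qed.

(** The path is extended at its front: x is adjacent to ay or to y = a(ay), so
the pair y, ay can be put before x in one of the two orders. *)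
Lemma antipodal_path_extend x s y :
  path e x (behead (with_antipodes (x :: s))) ->
  uniq (with_antipodes (x :: s)) -> y \notin with_antipodes (x :: s) ->
  exists z, path e z (behead (with_antipodes [:: z, x & s])) /\
            uniq (with_antipodes [:: z, x & s]).
Proof.
move=> px us ys.
have [exay|nexay] := boolP (e x (a y)).
  exists y; rewrite uniq_with_antipodes_cons //; split=> //.
  by move: px; rewrite /= !adj_antipode e_sym exay.
exists (a y); rewrite uniq_with_antipodes_cons ?mem_with_antipodes //; split=> //.
by have := e_anti x y; move: px; rewrite /= !adj_antipode aK e_sym (negPf nexay) orbF => -> ->.
Qed.

Lemma antipodal_hamiltonian_path (x0 : T) :
  exists x s, [/\ path e x (behead (with_antipodes (x :: s))),
                  uniq (with_antipodes (x :: s))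
                & with_antipodes (x :: s) =i T].
Proof.
suff ext k x s : path e x (behead (with_antipodes (x :: s))) ->
    uniq (with_antipodes (x :: s)) ->
    #|T| - size (with_antipodes (x :: s)) <= k ->
    exists x s, [/\ path e x (behead (with_antipodes (x :: s))),
                  uniq (with_antipodes (x :: s))
                & with_antipodes (x :: s) =i T].
  apply: (ext #|T| x0 [::] _ _ (leq_subr _ _)); first by rewrite /= adj_antipode.
  exact: uniq_with_antipodes_cons.
elim: k x s => [|k IH] x s px us le_k.
  have [||_ eqT] := uniq_min_size us (s2 := enum T).
  - by move=> y _; rewrite mem_enum.
  - by rewrite -cardT -subn_eq0 -leqn0.
  by exists x, s; split=> // y; rewrite eqT mem_enum.
have [cov|/fintype.subsetPn[y _ ys]] := boolP (T \subset with_antipodes (x :: s)).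
  by exists x, s; split=> // y; rewrite (fintype.subsetP cov).
have [z [pz uz]] := antipodal_path_extend px us ys.
by apply: (IH z (x :: s)) => //=; move: le_k => /=; lia.
Qed.

(** The rotation of Dirac and Posa: for consecutive vertices u, y of a path,
chords from its first vertex to y and from u to its last vertex close it up once
the part after u is reversed. *)
Lemma rotated_path_cycle x y p q :
  path e x (p ++ y :: q) -> e x y -> e (last x p) (last y q) ->
  cycle e (x :: p ++ rev (y :: q)).
Proof.
rewrite cat_path /= => /and3P[xp _ yq] exy epq.
rewrite rev_cons -rcons_cat !rcons_path last_rcons cat_path last_cat xp.
rewrite (e_sym y) exy andbT /=.
have := rev_path e y q; rewrite (@eq_path _ _ e) => [|u v]; last exact: e_sym.
case: (lastP q) yq epq => [|q' z] yq epq; first by rewrite /= epq.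
rewrite belast_rcons rev_cons last_rcons rcons_path yq in epq *.
by move=> /andP[zq qy]; rewrite rev_rcons /= epq zq.
Qed.

Lemma last_with_antipodes x s : last (a x) (with_antipodes s) = a (last x s).
Proof. by elim: s x => //= y s IH x. Qed.

Lemma with_antipodes_cat s1 s2 :
  with_antipodes (s1 ++ s2) = with_antipodes s1 ++ with_antipodes s2.
Proof. by rewrite /with_antipodes map_cat flatten_cat. Qed.

(** Let t be the last vertex of a Hamiltonian path x, ax, x2, ax2, ..., and
suppose that t is not adjacent to x, hence adjacent to ax. Take the first pair
y, ay after x with t not adjacent to ay; it exists because t is not ax and so is
itself some ay. Then t is adjacent to y and to the vertex aw just before y.
According as x is adjacent to y or to ay, the path can be rotated at the edge
aw, y or at the edge y, ay. *)
Lemma antipodal_hamiltonian_cycle (x0 : T) :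
  exists p, [/\ uniq p, p =i T & cycle e p].
Proof.
have [x [s [px us cov]]] := antipodal_hamiltonian_path x0.
have pxs : path e x (a x :: with_antipodes s) by [].
have rot p y q : a x :: with_antipodes s = p ++ y :: q ->
    e x y -> e (last x p) (a (last x s)) ->
    exists p, [/\ uniq p, p =i T & cycle e p].
  move=> sE exy ep.
  have lastE : last y q = a (last x s).
    by have := congr1 (last x) sE; rewrite /= last_with_antipodes last_cat.
  have permE : perm_eq (x :: p ++ rev (y :: q)) (with_antipodes (x :: s)).
    by rewrite -[with_antipodes _]/(x :: a x :: _) sE perm_cons perm_cat2l perm_rev.
  exists (x :: p ++ rev (y :: q)); split.
  - by rewrite (perm_uniq permE).
  - by move=> u; rewrite (perm_mem permE).
  - by apply: rotated_path_cycle; rewrite ?lastE // -sE.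
have first_split (P : pred T) : has P s -> exists y s1 s2,
    [/\ s = rcons s1 y ++ s2, P y & ~~ has P s1].
  by case/split_find => y s1 s2; exists y, s1, s2.
pose t := a (last x s); have [etx|netx] := boolP (e t x).
  exists (with_antipodes (x :: s)); split=> //.
  by rewrite [cycle _ _]rcons_path px /= last_with_antipodes.
have etax : e t (a x) by have := e_anti t x; rewrite (negPf netx).
have : has (fun y => ~~ e t (a y)) s.
  apply/hasP; exists (last x s); last by rewrite e_irr.
  case: (s) @t etax {netx} => [|y s'] /=; first by rewrite e_irr.
  by rewrite mem_last.
move=> /first_split[y [s1 [s2 [sE netay s1_t]]]].
have etw : e t (a (last x s1)).
  case: (lastP s1) s1_t => [|s' w] //.
  by rewrite has_rcons negb_or negbK last_rcons => /andP[].
have sE' : with_antipodes s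
    = with_antipodes s1 ++ [:: y, a y & with_antipodes s2].
  by rewrite sE cat_rcons with_antipodes_cat.
have [exy|nexy] := boolP (e x y).
  apply: (rot (a x :: with_antipodes s1) _ _ _ exy); first by rewrite sE'.
  by rewrite /= last_with_antipodes e_sym.
apply: (rot (a x :: rcons (with_antipodes s1) y) (a y) (with_antipodes s2)).
- by rewrite sE' -cat_rcons.
- by have := e_anti x y; rewrite (negPf nexy).
- by rewrite /= last_rcons e_sym; have := e_anti t y; rewrite (negPf netay) orbF.
Qed.

End Antipodal.

Local Open Scope ring_scope.

(** * Permutations without a common prefix *)

(** Equivalently, s maps I onto {0, ..., |I| - 1}; this form spares all
counting. *)
Definition is_prefix n (s : 'S_n) (I : {set 'I_n}) : bool :=
  [forall i in I, forall j in ~: I, (s i < s j)%N].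

Definition no_common_prefix n : rel 'S_n := fun s t =>
  ~~ [exists I : {set 'I_n},
       [&& I != finset.set0, ~: I != finset.set0, is_prefix s I & is_prefix t I]].

Definition complement_perm n (s : 'S_n) : 'S_n := (s * perm rev_ord_inj)%g.

Lemma is_prefixP n (s : 'S_n) (I : {set 'I_n}) :
  reflect (forall i j, i \in I -> j \notin I -> (s i < s j)%N) (is_prefix s I).
Proof.
apply: (iffP forall_inP) => [sI i j iI jI|sI i iI].
  by have /forall_inP := sI i iI; apply; rewrite finset.in_setC.
by apply/forall_inP => j; rewrite finset.in_setC; apply: sI.
Qed.

Lemma no_common_prefix_sym n : symmetric (@no_common_prefix n).
Proof.
by move=> s t; congr (~~ _); apply: eq_existsb => I; rewrite [is_prefix s I && _]andbC.
Qed.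

(** A vertex has itself as a non-neighbour because the index of the least value
is a prefix on its own; with a single index there would be no proper nonempty
prefix. *)
Lemma no_common_prefix_irr n : (1 < n)%N -> irreflexive (@no_common_prefix n).
Proof.
case: n => [|[|n]] // _ s; apply/negbTE; rewrite negbK; apply/existsP.
exists [set (s^-1)%g ord0]%SET; rewrite andbb; apply/and3P; split.
- by apply/finset.set0Pn; exists ((s^-1)%g ord0); rewrite finset.set11.
- apply/finset.set0Pn; exists ((s^-1)%g ord_max).
  by rewrite !finset.inE (inj_eq perm_inj).
- apply/is_prefixP => i j; rewrite !finset.inE => /eqP-> nj.
  rewrite permKV lt0n; apply: contraNneq nj => sj0.
  by apply/eqP/(@perm_inj _ s)/val_inj; rewrite permKV.
Qed.

Lemma complement_permE n (s : 'S_n) i : complement_perm s i = rev_ord (s i).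
Proof. by rewrite permM permE. Qed.

Lemma complement_permK n : involutive (@complement_perm n).
Proof. by move=> s; apply/permP => i; rewrite !complement_permE rev_ordK. Qed.

Lemma prefixes_nested n (s : 'S_n) (I J : {set 'I_n}) :
  is_prefix s I -> is_prefix s J -> (I \subset J) || (J \subset I).
Proof.
move=> /is_prefixP sI /is_prefixP sJ.
have [//|/fintype.subsetPn[i iI iJ]] := boolP (I \subset J).
apply/fintype.subsetP => j jJ; apply/negPn/negP => jI.
by have := ltn_trans (sI _ _ iI jI) (sJ _ _ jJ iJ); rewrite ltnn.
Qed.

(** The common prefixes I of s, t and J of s, complement t are comparable, as
prefixes of s. An index i of the smaller one and an index j outside the larger
one satisfy t i < t j because of I, and t j < t i because of J. *)
Lemma no_common_prefix_complement n (s t : 'S_n) :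
  no_common_prefix s t || no_common_prefix s (complement_perm t).
Proof.
rewrite -negb_and; apply/negP => /andP[/existsP[I /and4P[I0 I1 sI tI]]].
move=> /existsP[J /and4P[J0 J1 sJ tJ]].
have [i [j [iI jI iJ jJ]]] :
    exists i j, [/\ i \in I, j \notin I, i \in J & j \notin J].
  have [IJ|JI] := orP (prefixes_nested sI sJ).
    have [i iI] := finset.set0Pn _ I0; have [j] := finset.set0Pn _ J1.
    rewrite finset.in_setC => jJ; exists i, j; split=> //; last exact: (fintype.subsetP IJ).
    by apply: contraNN jJ; apply: (fintype.subsetP IJ).
  have [i iJ] := finset.set0Pn _ J0; have [j] := finset.set0Pn _ I1.
  rewrite finset.in_setC => jI; exists i, j; split=> //; first exact: (fintype.subsetP JI).
  by apply: contraNN jI; apply: (fintype.subsetP JI).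
have := is_prefixP _ _ tI _ _ iI jI; have := is_prefixP _ _ tJ _ _ iJ jJ.
rewrite !complement_permE /=; lia.
Qed.

(** * Vertices and proper faces of the permutohedron *)

Local Open Scope classical_set_scope.
Section Geometry.
Variables (R : realType) (n : nat).
Implicit Types (A : set 'rV[R]_n) (c x y : 'rV[R]_n) (s t : 'S_n).
Local Notation Perm := (permutohedron R n).

Lemma dotDr c x y : dot c (x + y) = dot c x + dot c y.
Proof. by rewrite -big_split; apply: eq_bigr => i _; rewrite mxE mulrDr. Qed.

Lemma dotZr c (k : R) x : dot c (k *: x) = k * dot c x.
Proof. by rewrite mulr_sumr; apply: eq_bigr => i _; rewrite mxE mulrCA. Qed.

Lemma hull_ind A (P : set 'rV[R]_n) :
  (forall x y (k : R), 0 < k -> k < 1 -> P x -> P y -> P (k *: x + (1 - k) *: y)) ->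
  A `<=` P -> convex_hull A `<=` P.
Proof.
move=> Pconv; apply: smallest_sub.
apply/convex_setW => x y; rewrite !inE => Px Py k k0 k1; rewrite inE.
exact: Pconv.
Qed.

Lemma sub_hull A : A `<=` convex_hull A.
Proof. exact: sub_gen_smallest. Qed.

Lemma hull_dot_eq A c b : A `<=` [set x | dot c x = b] ->
  convex_hull A `<=` [set x | dot c x = b].
Proof.
by apply: hull_ind => x y k k0 k1 /=; rewrite dotDr !dotZr => -> ->; lra.
Qed.

(** If x were not in A then a functional exposing x would be smaller at every
point of A than at x, hence at every point of the hull, which contains x. *)
Lemma hull_vertex A x : polytope_vertex (convex_hull A) x -> A x.
Proof.
move=> [c [b [le_b xE]]]; apply: contrapT => nAx.
have [Qx cx] : (convex_hull A `&` [set y | dot c y = b]) x by rewrite -xE.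
suff : convex_hull A `<=` [set y | dot c y < b].
  by move=> /(_ _ Qx) /=; rewrite [dot c x]cx ltxx.
apply: hull_ind => [u v k k0 k1 /=|y Ay /=]; first by rewrite dotDr !dotZr; nra.
rewrite lt_neqAle le_b ?andbT; last exact: sub_hull.
apply/eqP => cy; have : [set x] y by rewrite xE; split=> //; exact: sub_hull.
by move=> /= yx; apply: nAx; rewrite -yx.
Qed.

(** The set of points with dot c y < dot c c, with the point c added, is convex
and contains A, so it contains the hull. *)
Lemma exposed_hull_vertex A c : A c ->
  (forall y, A y -> y <> c -> dot c y < dot c c) ->
  polytope_vertex (convex_hull A) c.
Proof.
move=> Ac lt_c.
have hullE : convex_hull A `<=` [set y | dot c y < dot c c \/ y = c].
  apply: hull_ind => [x y k k0 k1 /=|y Ay].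
    rewrite dotDr !dotZr => -[xc|->] [yc|->]; try by left; nra.
    by right; rewrite -scalerDl addrC subrK scale1r.
  by have [->|/eqP] := eqVneq y c; [right | left; apply: lt_c].
exists c, (dot c c); split=> [x /hullE[/ltW|->]|] //.
rewrite seteqP; split=> x /=; first by move=> ->; split=> //; exact: sub_hull.
by move=> [/hullE[/lt_eqF/eqP ne e|]].
Qed.

Lemma perm_point_inj : injective (@perm_point R n).
Proof.
move=> s t /rowP st; apply/permP => i; apply: val_inj; apply: succn_inj.
by apply/eqP; rewrite -(eqr_nat R); have := st i; rewrite !mxE => ->.
Qed.

Lemma dot_perm_pointE s c : dot c (perm_point R s) = \sum_i c 0 i * (s i).+1%:R.
Proof. by apply: eq_bigr => i _; rewrite mxE. Qed.

Lemma dot_perm_point_norm s t :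
  dot (perm_point R s) (perm_point R s) = dot (perm_point R t) (perm_point R t).
Proof.
suff normE (u : 'S_n) : dot (perm_point R u) (perm_point R u) = \sum_(i < n) i.+1%:R ^+ 2.
  by rewrite !normE.
rewrite [RHS](reindex_inj (@perm_inj _ u)).
by apply: eq_bigr => i _; rewrite !mxE expr2.
Qed.

(** All the points perm_point s have the same norm, so
2 (x . x - x . y) = |x - y|^2 > 0 for two distinct ones. *)
Lemma dot_perm_point_lt s t : t <> s ->
  dot (perm_point R s) (perm_point R t) < dot (perm_point R s) (perm_point R s).
Proof.
move=> ts; set x := perm_point R s; set y := perm_point R t.
have [i xyi] : exists i, x 0 i != y 0 i.
  apply: contrapT => nxy; apply: ts; apply: perm_point_inj; apply/rowP => i.
  by apply/eqP/negPn/negP => xyi; apply: nxy; exists i; rewrite eq_sym.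
suff : 0 < dot x x + dot y y - dot x y *+ 2.
  by rewrite (dot_perm_point_norm t s) -/x; lra.
rewrite /dot -big_split -sumrMnl -sumrB /=.
rewrite (eq_bigr (fun j => (x 0 j - y 0 j) ^+ 2)) => [|j _]; last by rewrite sqrrB !expr2; ring.
rewrite (bigD1 i) //= ltr_pwDl ?exprn_even_gt0 ?subr_eq0 //.
by apply: sumr_ge0 => j _; exact: sqr_ge0.
Qed.

Lemma permutohedron_vertices :
  [set x | polytope_vertex Perm x] = range (@perm_point R n).
Proof.
rewrite seteqP; split=> x /=; first exact: hull_vertex.
move=> [s _ <-]; apply: exposed_hull_vertex; first by exists s.
by move=> _ [t _ <-] ts; apply: dot_perm_point_lt => tE; apply: ts; rewrite tE.
Qed.

Lemma dot_tperm c s (i j : 'I_n) : i != j ->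
  dot c (perm_point R (tperm i j * s)) - dot c (perm_point R s)
  = (c 0 j - c 0 i) * ((s i)%:R - (s j)%:R).
Proof.
move=> ij; rewrite !dot_perm_pointE -sumrB (bigD1 i) //= (bigD1 j) 1?eq_sym //=.
rewrite big1 ?addr0 => [|k /andP[ki kj]].
  by rewrite !permM tpermL tpermR -!natr1; ring.
by rewrite permM tpermD 1?eq_sym // subrr.
Qed.

(** Exchanging the values of s at i and j does not increase the functional. *)
Lemma maximizer_mono c s (i j : 'I_n) :
  (forall t, dot c (perm_point R t) <= dot c (perm_point R s)) ->
  c 0 i < c 0 j -> (s i < s j)%N.
Proof.
move=> smax cij.
have ij : i != j by apply: contraTneq cij => ->; rewrite ltxx.
have := smax (tperm i j * s)%g; rewrite -subr_le0 dot_tperm //.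
rewrite pmulr_rle0 ?subr_gt0 // subr_le0 ler_nat leq_eqVlt.
by rewrite (inj_eq val_inj) (inj_eq perm_inj) (negPf ij).
Qed.

Lemma dot_constant c s t : (forall i j, c 0 i = c 0 j) ->
  dot c (perm_point R s) = dot c (perm_point R t).
Proof.
move=> cc; rewrite !dot_perm_pointE.
rewrite (reindex_inj (@perm_inj _ (t * s^-1)%g)); apply: eq_bigr => i _.
by rewrite (cc _ i) permM permKV.
Qed.

(** A facet has smaller dimension than the polytope. *)
Lemma facet_proper Q F : @facet R n Q F -> F <> Q.
Proof.
move=> [_ [d [[Qd _] [_ Fd]]]] FQ; move: Qd; rewrite -FQ => /Fd.
by rewrite ltnn.
Qed.

(** The functional c that cuts out F is not constant, since it would otherwise
be constant on the permutohedron. If c i < c j then the set where c is below c j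
is proper and nonempty, and it is a prefix of every maximizer of c. *)
Lemma proper_face_common_prefix F s t : face Perm F -> F <> Perm ->
  F (perm_point R s) -> F (perm_point R t) -> ~~ no_common_prefix s t.
Proof.
move=> [c [b [le_b ->]]] Fproper [Qs cs] [Qt ct].
have [[i j] /= cij] : exists p : 'I_n * 'I_n, c 0 p.1 < c 0 p.2.
  apply: contrapT => ncij; apply: Fproper.
  have cc i j : c 0 i = c 0 j.
    by apply/le_anti/andP; split; rewrite leNgt; apply/negP => lt_c;
      apply: ncij; [exists (j, i) | exists (i, j)].
  rewrite seteqP; split=> [x []//|x Qx]; split=> //; move: x Qx.
  by apply: hull_dot_eq => _ [u _ <-] /=; rewrite (dot_constant u s cc).
have sep (u : 'S_n) : dot c (perm_point R u) = b -> is_prefix u [set k | c 0 k < c 0 j]%SET.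
  move=> cu; apply/is_prefixP => k l; rewrite !finset.inE -leNgt => ckj cjl.
  apply: (@maximizer_mono c) (lt_le_trans ckj cjl) => v.
  by rewrite cu; apply: le_b; apply: sub_hull; exists v.
rewrite negbK; apply/existsP; exists [set k | c 0 k < c 0 j]%SET.
rewrite !sep // !andbT; apply/andP; split.
  by apply/finset.set0Pn; exists i; rewrite finset.inE.
by apply/finset.set0Pn; exists j; rewrite !finset.inE ltxx.
Qed.

Lemma no_common_prefix_adjacent s t : (1 < n)%N -> no_common_prefix s t ->
  adjacent (kneser_graph Perm) (perm_point R s) (perm_point R t).
Proof.
move=> n1 st.
have vtx (u : 'S_n) : polytope_vertex Perm (perm_point R u).
  suff : [set x | polytope_vertex Perm x] (perm_point R u) by [].
  by rewrite permutohedron_vertices; exists u.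
split=> //.
  by move=> /perm_point_inj stE; rewrite stE no_common_prefix_irr in st.
move=> [F [fF Fs Ft]]; have [faceF _] := fF.
by have := proper_face_common_prefix faceF (facet_proper fF) Fs Ft; rewrite st.
Qed.

End Geometry.

Theorem mainTheorem4 (R : realType) (n : nat) (hn : (3 <= n)%N) :
  hamiltonian (kneser_graph (permutohedron R n)).
Proof.
have n1 : (1 < n)%N by apply: ltn_trans hn.
have [p [up cov cp]] := antipodal_hamiltonian_cycle (no_common_prefix_irr n1)
  (@no_common_prefix_sym n) (@complement_permK n)
  (@no_common_prefix_complement n) 1%g.
exists [seq perm_point R s | s <- p]; split.
- rewrite size_map -(card_uniqP up) (eq_card cov) card_Sn.
  exact: leq_trans hn (fact_geq n).
- by rewrite map_inj_uniq //; exact: perm_point_inj.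
- rewrite [vertices _]permutohedron_vertices seteqP; split=> x /=.
    by move=> /mapP[s _ ->]; exists s.
  by move=> [s _ <-]; rewrite map_f ?cov.
- rewrite cycle_map; apply: sub_cycle cp => s t st; apply/asboolP.
  exact: no_common_prefix_adjacent.
Qed.
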